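(* For any positive integer $n$ such that $n>10$, there exists a pair of graphs $G$ and $H$ such that $\min\{i(G),i(H)\}=n+2$ and $i(G\times H)\le 12$.
   Context: All graphs are finite, simple, undirected, with nonempty vertex set. For a graph $G$, an independent dominating set is a set $I\subseteq V(G)$ that is independent and such that every vertex of $G$ is in $I$ or adjacent to a vertex of $I$ (equivalently, a maximal independent set with respect to inclusion). The independent domination number $i(G)$ is the minimum cardinality of an independent dominating set of $G$. The direct product $G\times H$ has vertex set $V(G)\times V(H)$ and edge set $\{(g_1,h_1)(g_2,h_2) : g_1g_2\in E(G)\text{ and } h_1h_2\in E(H)\}$. *)

(* Defs.v *)
From mathcomp Require Import all_boot.

Set Implicit Arguments.
Unset Strict Implicit.
Unset Printing Implicit Defensive.

Record sgraph := SGraph {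
  vertex :> finType;
  edge : rel vertex;
  edge_sym : symmetric edge;
  edge_irrefl : irreflexive edge;
  vertex_gt0 : 0 < #|vertex|
}.

Section IndependentDomination.

Variable G : sgraph.

Definition independent (I : {set G}) : bool :=
  [forall x in I, forall y in I, ~~ edge x y].

Definition dominating (I : {set G}) : bool :=
  [forall x : G, (x \in I) || [exists y in I, edge x y]].

Definition indep_dominating (I : {set G}) : bool :=
  independent I && dominating I.

Lemma indep_dominating_exists : exists I : {set G}, indep_dominating I.
Proof.
have ind0 : independent set0 by apply/forall_inP => x; rewrite inE.
have [I /maxsetP[indI maxI] _] := maxset_exists ind0.
exists I; rewrite /indep_dominating indI; apply/forallP => x.
apply/orP; case: (boolP [exists y in I, edge x y]) => [|/exists_inPn nbx]; first by right.
left; suff <- : x |: I = I by rewrite setU11.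
apply: maxI (subsetUr _ _).
apply/forall_inP => y yI; apply/forall_inP => z zI; move: yI zI.
case/setU1P => [->|yI] /setU1P[->|zI].
- by rewrite edge_irrefl.
- exact: nbx.
- by rewrite edge_sym nbx.
- by move/forall_inP: indI => /(_ y yI)/forall_inP; apply.
Qed.

Lemma indep_dominating_card_exists :
  exists k, [exists I : {set G}, indep_dominating I && (#|I| == k)].
Proof.
have [I idI] := indep_dominating_exists.
by exists #|I|; apply/existsP; exists I; rewrite idI eqxx.
Qed.

Definition indep_dom_number : nat := ex_minn indep_dominating_card_exists.

End IndependentDomination.

Section DirectProduct.

Variables G H : sgraph.

Definition dprod_edge : rel (G * H)%type :=
  fun u v => edge u.1 v.1 && edge u.2 v.2.

Lemma dprod_edge_sym : symmetric dprod_edge.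
Proof. by move=> u v; rewrite /dprod_edge edge_sym [edge u.2 _]edge_sym. Qed.

Lemma dprod_edge_irrefl : irreflexive dprod_edge.
Proof. by move=> u; rewrite /dprod_edge edge_irrefl. Qed.

Lemma dprod_vertex_gt0 : 0 < #|{: G * H}|.
Proof. by rewrite card_prod muln_gt0 !vertex_gt0. Qed.

Definition direct_product : sgraph :=
  SGraph dprod_edge_sym dprod_edge_irrefl dprod_vertex_gt0.

End DirectProduct.

(* Main.v *)
Require Import Defs.
From mathcomp Require Import all_boot.

(** The diagonal of a five-element set can dominate a product although
    neither factor has a small independent dominating set.

    Colour the edges of K_5 with two colours, each forming a 5-cycle: the
    pentagon (steps of +-1 modulo 5) and the pentagram (steps of +-2).
    From either 5-cycle C build a graph with core C as follows.  The maximal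
    independent sets of C are exactly the five neighbourhoods N(j); for each j
    add n new vertices, the tips at j, adjacent to precisely the core vertices
    outside N(j).  An independent dominating set meets the core in an
    independent set, so in a subset of some N(j), and it must then contain all
    n tips at j.  If it contains both vertices of N(j) it has at least n + 2
    elements; if it has no core vertex other than some x, then x lies in two
    neighbourhoods and 2n tips are forced.  The value n + 2 is attained by N(j)
    together with its tips ([indep_dom_number_crown]).

    In the product of the graph built on the pentagon with that built on the
    pentagram, the diagonal of the two cores is independent, because the two
    cycles share no edge.  It is dominating because for every pair of vertices
    outside it some k among the five is, as a core vertex, adjacent to the
    first in one factor and to the second in the other.  Only the indices of
    the tips matter here, so this is a finite check on the two 5-cycles
    ([diag_core_core], [diag_core_tip], [diag_tip_core], [diag_tip_tip]).
    So the product has independent domination number at most 5. *)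

Set Implicit Arguments.
Unset Strict Implicit.
Unset Printing Implicit Defensive.

(** * Independent domination number as a minimum *)

Lemma indep_dom_number_le (G : sgraph) (I : {set G}) :
  indep_dominating I -> indep_dom_number G <= #|I|.
Proof.
move=> idI; rewrite /indep_dom_number; case: ex_minnP => m _; apply.
by apply/existsP; exists I; rewrite idI eqxx.
Qed.

Lemma leq_indep_dom_number (G : sgraph) m :
  (forall I : {set G}, indep_dominating I -> m <= #|I|) ->
  m <= indep_dom_number G.
Proof.
move=> mP; rewrite /indep_dom_number; case: ex_minnP => k.
by case/existsP=> I /andP[idI /eqP <-] _; apply: mP.
Qed.

Lemma independentP (G : sgraph) (I : {set G}) :
  reflect {in I &, forall x y, ~~ edge x y} (independent I).
Proof.
apply: (iffP forall_inP) => [indI x y xI yI | indI x xI].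
  by have /forall_inP := indI x xI; apply.
by apply/forall_inP => y; apply: indI.
Qed.

Lemma dominatingP (G : sgraph) (I : {set G}) :
  reflect (forall x, x \notin I -> exists2 y, y \in I & edge x y)
          (dominating I).
Proof.
apply: (iffP forallP) => [domI x | domI x].
  by case/orP: (domI x) => [-> // | /exists_inP].
by case: (boolP (x \in I)) => //= xI; apply/exists_inP/domI.
Qed.

(** * The two edge-disjoint 5-cycles on five points *)

(** The 5-cycle of steps +-d: the pentagon for d = 1, the pentagram for
    d = 2. *)
Definition cyc5 (d i j : nat) : bool :=
  (j == (i + d) %% 5) || (i == (j + d) %% 5).

(** On a list of numerals, unlike on the finite type ['I_5], existence reduces
    to a boolean by computation. *)
Lemma has5P (P : pred nat) : has P (iota 0 5) -> exists k : 'I_5, P k.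
Proof.
by case/hasP=> k; rewrite mem_iota => /= k5 Pk; exists (Ordinal k5).
Qed.

Ltac case5 i := case: i => [[|[|[|[|[|//]]]]] ?].

Lemma cyc5_sym d : symmetric (cyc5 d).
Proof. by move=> i j; rewrite /cyc5 orbC. Qed.

Section Cycle.

Variables (d : nat) (hd : 0 < d < 3).

Lemma cyc5_irrefl (i : 'I_5) : ~~ cyc5 d i i.
Proof. by move: hd; case: d => [|[|[|//]]] // _; case5 i. Qed.

Lemma cyc5_triangle_free (j x y : 'I_5) :
  cyc5 d x j -> cyc5 d y j -> ~~ cyc5 d x y.
Proof.
by move: hd; case: d => [|[|[|//]]] // _; case5 j; case5 x; case5 y.
Qed.

Lemma cyc5_nbr2 (j : 'I_5) :
  exists x y : 'I_5, [/\ x != y, cyc5 d x j & cyc5 d y j].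
Proof.
exists (inord ((j + d) %% 5)), (inord ((j + (5 - d)) %% 5)).
rewrite -val_eqE /= !inordK ?ltn_pmod //.
by move: hd; case: d => [|[|[|//]]] // _; case5 j.
Qed.

Lemma cyc5_nbr_eq (j x y z : 'I_5) :
  x != y -> cyc5 d x j -> cyc5 d y j -> cyc5 d z j -> z = x \/ z = y.
Proof.
move=> xy xj yj zj; suff /orP[/eqP|/eqP]: (z == x) || (z == y) by auto.
rewrite -!val_eqE; move: xy xj yj zj.
move: hd; case: d => [|[|[|//]]] // _; rewrite -val_eqE.
  by case5 j; case5 x; case5 y => //; case5 z.
by case5 j; case5 x; case5 y => //; case5 z.
Qed.

(** Two non-adjacent vertices of a 5-cycle have a common neighbour j and form
    a maximal independent set, so that set is the neighbourhood of j. *)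
Lemma cyc5_indep_nbr (x y : 'I_5) :
  x != y -> ~~ cyc5 d x y ->
  exists j : 'I_5, [/\ cyc5 d x j, cyc5 d y j &
    forall z : 'I_5, ~~ cyc5 d x z -> ~~ cyc5 d y z -> cyc5 d z j].
Proof.
(* 3 is the inverse of 2 modulo 5, so this is the midpoint of x and y. *)
move=> xy nxy; exists (inord ((3 * (x + y)) %% 5)).
rewrite !inordK ?ltn_pmod //; move: xy nxy; rewrite -val_eqE.
move: hd; case: d => [|[|[|//]]] // _.
  by case5 x; case5 y => // _ _; split=> // z; case5 z.
by case5 x; case5 y => // _ _; split=> // z; case5 z.
Qed.

Lemma cyc5_incomparable (i j : 'I_5) :
  i != j -> exists k : 'I_5, cyc5 d k i && ~~ cyc5 d k j.
Proof.
move=> ij; apply/(@has5P (fun k => cyc5 d k i && ~~ cyc5 d k j)).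
by move: ij; move: hd; case: d => [|[|[|//]]] // _; case5 i; case5 j.
Qed.

End Cycle.

(** The next four lemmas produce the diagonal vertex that dominates a given
    vertex of the product, one lemma for each way in which its two components
    can be core vertices or tips.  A core vertex i of the pentagon side asks
    for k adjacent to i, a tip at i for k not adjacent to i; only two core
    vertices with i = j ask for the impossible, and these form the diagonal
    itself. *)
Lemma diag_core_core (i j : 'I_5) :
  i != j -> exists k : 'I_5, cyc5 1 i k && cyc5 2 j k.
Proof.
move=> ij; apply/(@has5P (fun k => cyc5 1 i k && cyc5 2 j k)).
by move: ij; case5 i; case5 j.
Qed.

Lemma diag_core_tip (i j : 'I_5) :
  exists k : 'I_5, cyc5 1 i k && ~~ cyc5 2 k j.
Proof.
apply/(@has5P (fun k => cyc5 1 i k && ~~ cyc5 2 k j)).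
by case5 i; case5 j.
Qed.

Lemma diag_tip_core (i j : 'I_5) :
  exists k : 'I_5, ~~ cyc5 1 k i && cyc5 2 j k.
Proof.
apply/(@has5P (fun k => ~~ cyc5 1 k i && cyc5 2 j k)).
by case5 i; case5 j.
Qed.

Lemma diag_tip_tip (i j : 'I_5) :
  exists k : 'I_5, ~~ cyc5 1 k i && ~~ cyc5 2 k j.
Proof.
apply/(@has5P (fun k => ~~ cyc5 1 k i && ~~ cyc5 2 k j)).
by case5 i; case5 j.
Qed.

Lemma pentagon_step : 0 < 1 < 3. Proof. by []. Qed.
Lemma pentagram_step : 0 < 2 < 3. Proof. by []. Qed.

Lemma cyc5_disjoint (i j : 'I_5) : ~~ (cyc5 1 i j && cyc5 2 i j).
Proof. by case5 i; case5 j. Qed.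

(** * A 5-cycle crowned with tips *)

Section Crown.

Variables (d : nat) (hd : 0 < d < 3) (n : nat).

(** Each N(j), which is a maximal independent set of the cycle, fails to
    dominate the tips at j; every other maximal independent set dominates
    them. *)
Definition crown_edge : rel ('I_5 + 'I_5 * 'I_n)%type := fun u v =>
  match u, v with
  | inl i, inl j => cyc5 d i j
  | inl i, inr t => ~~ cyc5 d i t.1
  | inr t, inl i => ~~ cyc5 d i t.1
  | inr _, inr _ => false
  end.

Lemma crown_edge_sym : symmetric crown_edge.
Proof. by case=> [i|t] [j|u] //=; rewrite cyc5_sym. Qed.

Lemma crown_edge_irrefl : irreflexive crown_edge.
Proof. by case=> [i|t] //=; apply/negbTE/cyc5_irrefl. Qed.

Lemma crown_vertex_gt0 : 0 < #|{: 'I_5 + 'I_5 * 'I_n}|.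
Proof. by rewrite card_sum card_ord. Qed.

Definition crown : sgraph :=
  SGraph crown_edge_sym crown_edge_irrefl crown_vertex_gt0.

Definition core (i : 'I_5) : crown := inl i.
Definition tip (j : 'I_5) (k : 'I_n) : crown := inr (j, k).
Definition tips (j : 'I_5) : {set crown} := [set tip j k | k : 'I_n].

Lemma mem_tips (i j : 'I_5) (k : 'I_n) : (tip i k \in tips j) = (i == j).
Proof.
apply/imsetP/eqP => [[k' _ [-> _]] // | ->]; by exists k.
Qed.

Lemma core_tips i j : (core i \in tips j) = false.
Proof. by apply/imsetP => -[]. Qed.

Lemma card_tips j : #|tips j| = n.
Proof. by rewrite card_imset ?card_ord // => k k' []. Qed.

Lemma card_nbr_tips (j x y : 'I_5) :
  x != y -> #|[set core x; core y] :|: tips j| = n + 2.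
Proof.
move=> xy; rewrite cardsU disjoint_setI0 ?cards0 ?subn0.
  by rewrite card_tips cards2 (inj_eq (@inl_inj _ _)) xy addnC.
rewrite disjoint_subset; apply/subsetP => v; rewrite !inE.
by case/orP=> /eqP->; rewrite core_tips.
Qed.

(** The tips at j have no neighbour in N(j) and none among the tips, so they
    are undominated unless chosen. *)
Lemma tips_sub (I : {set crown}) (j : 'I_5) :
  dominating I -> (forall z, core z \in I -> cyc5 d z j) -> tips j \subset I.
Proof.
move/dominatingP=> domI Ij; apply/subsetP => _ /imsetP[k _ ->].
apply: contraT => /domI[[z|t] zI] //= /negP[].
exact: Ij zI.
Qed.

Lemma nbr_tips_indep_dominating (j x y : 'I_5) :
  0 < n -> x != y -> cyc5 d x j -> cyc5 d y j ->
  indep_dominating ([set core x; core y] :|: tips j).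
Proof.
move=> n0 xy xj yj.
have coreI z : (core z \in [set core x; core y] :|: tips j) = cyc5 d z j.
  rewrite !inE core_tips orbF !(inj_eq (@inl_inj _ _)).
  apply/orP/idP => [[]/eqP-> // |].
  by case/(cyc5_nbr_eq hd xy xj yj)=> ->; [left | right].
have tipI i k : (tip i k \in [set core x; core y] :|: tips j) = (i == j).
  by rewrite !inE mem_tips.
apply/andP; split.
  apply/independentP => -[a|[a k]] [b|[b l]]; rewrite ?coreI ?tipI //=.
  - exact: cyc5_triangle_free.
  - by move=> aj /eqP->; rewrite aj.
  - by move=> /eqP-> bj; rewrite bj.
apply/dominatingP => -[a|[a k]]; rewrite ?coreI ?tipI.
  by move=> aj; exists (tip j (Ordinal n0)); rewrite ?tipI.
rewrite eq_sym => /(cyc5_incomparable hd)[z /andP[zj za]].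
by exists (core z); rewrite ?coreI.
Qed.

(** For n > 1 a single core vertex x is no saving: the tips at both
    neighbours of x are then forced, and 2n >= n + 2. *)
Lemma crown_indep_dominating_ge (I : {set crown}) :
  1 < n -> indep_dominating I -> n + 2 <= #|I|.
Proof.
move=> n1 /andP[/independentP indI domI].
case: (boolP [exists x, exists y, [&& x != y, core x \in I & core y \in I]]).
  case/existsP=> x /existsP[y /and3P[xy xI yI]].
  have [j [xj yj zj]] := cyc5_indep_nbr hd xy (indI _ _ xI yI).
  rewrite -(card_nbr_tips j xy); apply: subset_leq_card.
  rewrite !subUset !sub1set xI yI /=; apply: tips_sub domI _ => z zI.
  by apply: zj; [apply: indI xI zI | apply: indI yI zI].
move=> few; have [x Ix] : exists x, forall z, core z \in I -> z = x.
  case: (pickP (fun x => core x \in I)) => [x xI | none]; last first.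
    by exists ord0 => z; rewrite none.
  exists x => z zI; apply/eqP; apply: contraNT few => zx.
  by apply/existsP; exists z; apply/existsP; exists x; apply/and3P.
have [j [l [jl jx lx]]] := cyc5_nbr2 hd x.
have subI (i : 'I_5) : cyc5 d i x -> tips i \subset I.
  by move=> ix; apply: tips_sub domI _ => z /Ix->; rewrite cyc5_sym.
have: #|tips j :|: tips l| <= #|I|.
  by apply: subset_leq_card; rewrite subUset !subI.
rewrite cardsU disjoint_setI0 ?cards0 ?subn0 ?card_tips.
  by apply: leq_trans; rewrite leq_add2l.
rewrite disjoint_subset; apply/subsetP => _ /imsetP[k _ ->].
by rewrite inE /= mem_tips.
Qed.

Lemma indep_dom_number_crown : 1 < n -> indep_dom_number crown = n + 2.
Proof.
move=> n1; apply/eqP; rewrite eqn_leq; apply/andP; split.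
  have [x [y [xy xj yj]]] := cyc5_nbr2 hd ord0.
  rewrite -(card_nbr_tips ord0 xy); apply: indep_dom_number_le.
  exact: nbr_tips_indep_dominating (ltnW n1) xy xj yj.
by apply: leq_indep_dom_number => I; apply: crown_indep_dominating_ge.
Qed.

End Crown.

(** * The diagonal of the two cores *)

Section Diagonal.

Variables (m n : nat).

Let G := crown pentagon_step m.
Let H := crown pentagram_step n.

Definition diag : {set direct_product G H} :=
  [set (core pentagon_step m i, core pentagram_step n i) | i : 'I_5].

Lemma diag_indep_dominating : indep_dominating diag.
Proof.
have diagI k : (core pentagon_step m k, core pentagram_step n k) \in diag by apply: imset_f.
apply/andP; split.
  apply/independentP => _ _ /imsetP[i _ ->] /imsetP[j _ ->].
  exact: cyc5_disjoint.
apply/dominatingP => -[[i|[i a]] [j|[j b]]] => [ijI|_|_|_].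
- have [|k ijk] := @diag_core_core i j.
    by apply: contraNneq ijI => ->; apply: diagI.
  by exists (core pentagon_step m k, core pentagram_step n k).
- by have [k ijk] := diag_core_tip i j; exists (core pentagon_step m k, core pentagram_step n k).
- by have [k ijk] := diag_tip_core i j; exists (core pentagon_step m k, core pentagram_step n k).
- by have [k ijk] := diag_tip_tip i j; exists (core pentagon_step m k, core pentagram_step n k).
Qed.

Lemma indep_dom_number_crown_product :
  indep_dom_number (direct_product G H) <= 5.
Proof.
apply: leq_trans (indep_dom_number_le diag_indep_dominating) _.
by rewrite -[leqRHS]card_ord; apply: leq_imset_card.
Qed.

End Diagonal.

Theorem theorem1 (n : nat) (hn : 10 < n) :
  exists G H : sgraph,
    minn (indep_dom_number G) (indep_dom_number H) = n + 2 /\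
    indep_dom_number (direct_product G H) <= 12.
Proof.
have n1 : 1 < n by apply: leq_trans hn.
exists (crown pentagon_step n), (crown pentagram_step n); split.
  by rewrite !indep_dom_number_crown // minnn.
by apply: leq_trans (indep_dom_number_crown_product n n) _.
Qed.
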